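(* For every integer $n\ge 1$, the cubature formula $$\frac12\int_{\Omega_H}f(\mathbf t)\,d\mathbf t=\frac1{4n^3}\sum_{\mathbf j\in\mathbb H_n^*}c^{(n)}_{\mathbf j}f(\tfrac{\mathbf j}{4n})$$ is exact for all $f\in\mathcal T_{2n-1}$.
   Context: Let $\mathbb R^4_H=\{\mathbf t\in\mathbb R^4: t_1+t_2+t_3+t_4=0\}$ with its 3-dimensional Lebesgue measure $d\mathbf t$, $\mathbb Z^4_H=\mathbb Z^4\cap\mathbb R^4_H$, and $\Omega_H=\{\mathbf t\in\mathbb R^4_H: -1<t_i-t_j\le 1,\ 1\le i<j\le4\}$ (volume $2$). Let $\mathbb H=\{\mathbf k\in\mathbb Z^4_H: k_1\equiv k_2\equiv k_3\equiv k_4\pmod 4\}$, $\phi_{\mathbf k}(\mathbf t)=e^{\frac{\pi i}{2}\mathbf k\cdot\mathbf t}$, $\mathbb H_m^*=\{\mathbf k\in\mathbb H: -4m\le k_i-k_j\le 4m,\ 1\le i<j\le4\}$ and $\mathcal T_m=\operatorname{span}\{\phi_{\mathbf k}:\mathbf k\in\mathbb H_m^*\}$. For $\mathbf k\in\mathbb H_n^*$ define $c^{(n)}_{\mathbf k}=1$ if $\max_ik_i-\min_ik_i<4n$, and otherwise $c^{(n)}_{\mathbf k}=1/\binom{p+q}{p}$, where $p$ (resp. $q$) is the number of coordinates of $\mathbf k$ equal to $\max_i k_i$ (resp. $\min_ik_i$). *)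

(* Defs.v *)
From HB Require Import structures.
From mathcomp Require Import all_boot all_order all_algebra.
From mathcomp Require Import all_classical all_reals all_analysis.
From mathcomp Require Import complex.
Set Implicit Arguments. Unset Strict Implicit. Unset Printing Implicit Defensive.
Import Order.TTheory GRing.Theory Num.Theory.
Local Open Scope classical_set_scope.
Local Open Scope ring_scope.

Section Defs.
Variable R : realType.

Definition vecR := 'I_4 -> R.
Definition vecZ := 'I_4 -> int.

Definition inRH (t : vecR) : Prop := \sum_(i < 4) t i = 0.

Definition inOmegaH (t : vecR) : Prop :=
  inRH t /\ forall i j : 'I_4, (i < j)%N -> -1 < t i - t j <= 1.

Definition inHlat (k : vecZ) : bool :=
  (\sum_(i < 4) k i == 0) && [forall i : 'I_4, forall j : 'I_4, (4 %| k i - k j)%Z].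

Definition inHstar (m : nat) (k : vecZ) : bool :=
  inHlat k && [forall i : 'I_4, forall j : 'I_4, (i < j)%N ==>
     ((- (4 * m)%:Z <= k i - k j) && (k i - k j <= (4 * m)%:Z))].

Definition dotZR (k : vecZ) (t : vecR) : R := \sum_(i < 4) (k i)%:~R * t i.

Definition phi (k : vecZ) (t : vecR) : R[i] :=
  let th := pi / 2 * dotZR k t in (cos th +i* sin th)%C.

(* An explicit finite list containing every element of H_m^*:
   integer vectors (a, b, c, -(a+b+c)) with |a|,|b|,|c| <= 3m.
   (Every k in H_m^* has |k_i| <= 3m, and the listing has no repetitions.) *)
Definition zbox (m : nat) : seq int :=
  [seq (i%:Z - (3 * m)%:Z) | i <- iota 0 (6 * m).+1].

Definition vec_of3 (x : int * int * int) : vecZ :=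
  fun i => nth 0 [:: x.1.1; x.1.2; x.2; - (x.1.1 + x.1.2 + x.2)] i.

Definition box3 (m : nat) : seq (int * int * int) :=
  [seq (ab, c) | ab <- [seq (a, b) | a <- zbox m, b <- zbox m], c <- zbox m].

Definition sum_Hstar (m : nat) (F : vecZ -> R[i]) : R[i] :=
  \sum_(x <- box3 m | inHstar m (vec_of3 x)) F (vec_of3 x).

Definition inT (m : nat) (f : vecR -> R[i]) : Prop :=
  exists a : vecZ -> R[i],
    forall t, inRH t -> f t = sum_Hstar m (fun k => a k * phi k t).

Definition cweight (n : nat) (k : vecZ) : R :=
  if [forall i : 'I_4, forall j : 'I_4, k i - k j < (4 * n)%:Z] then 1
  else
    let p := #|[set i : 'I_4 | [forall j, k j <= k i]]| in
    let q := #|[set i : 'I_4 | [forall j, k i <= k j]]| in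
    ('C(p + q, p)%:R)^-1.

Definition embH (x : R * R * R) : vecR :=
  fun i => nth 0 [:: x.1.1; x.1.2; x.2; - (x.1.1 + x.1.2 + x.2)] i.

Definition leb3 := product_measure1 (product_measure1 (@lebesgue_measure R) (@lebesgue_measure R)) (@lebesgue_measure R).

(* Integral over Omega_H w.r.t. the 3-dimensional Lebesgue measure of the
   hyperplane R^4_H (induced Euclidean measure).  Under the chart embH this
   measure is 2 dt1 dt2 dt3 (the Jacobian factor is sqrt 4 = 2), so that
   vol(Omega_H) = 2 as stated in the paper.  Complex integral = integral of
   real part + i * integral of imaginary part. *)
Definition int_OmegaH (f : vecR -> R[i]) : R[i] :=
  let D := [set x | inOmegaH (embH x)] in
  (2 * Rintegral leb3 D (fun x => complex.Re (f (embH x)))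
   +i* (2 * Rintegral leb3 D (fun x => complex.Im (f (embH x)))))%C.

Definition scale_pt (n : nat) (j : vecZ) : vecR :=
  fun i => (j i)%:~R / (4 * n)%:R.

End Defs.

(* Main.v *)
Require Import Defs.
From HB Require Import structures.
From mathcomp Require Import all_boot all_order all_algebra.
From mathcomp Require Import all_classical all_reals all_analysis.
From mathcomp Require Import measurable_realfun.
From mathcomp Require Import complex.
From mathcomp Require Import zify ring lra.
Set Implicit Arguments. Unset Strict Implicit. Unset Printing Implicit Defensive.
Import Order.TTheory GRing.Theory Num.Theory.
Import numFieldNormedType.Exports.

(** The four numbers [m_i = (k_i - k_4) / 4] turn [phi_k] into a character of
    the torus [R^3 / Z^3], both on the hyperplane and at the nodes.  The domain
    [Omega_H] is a fundamental domain for the translations by [Z^4_H]: a point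
    whose coordinates are reduced to [u] in [0, 1)^4 with sum [N] has exactly one
    translate in [Omega_H], obtained by subtracting 1 from the [N] largest
    coordinates (ties being broken by the index), so only the order type of [u]
    matters.  Likewise the translates of a node in the closed domain correspond
    to the ways of breaking the ties, and the weights [c_j] make them count for
    one.  Both sides of the formula can thus be computed on a cube, where
    they are products of one-dimensional integrals, respectively of geometric
    sums.  The integral of [phi_k] vanishes unless all [m_i] are 0; the sum
    vanishes unless [n] divides each [m_i] and [4n] divides their sum, and the
    bounds defining [T_(2n-1)] then force [m_i = 0]. *)

Local Open Scope nat_scope.

(** * Order types of four numbers *)

Local Notation allI4 P := (all P (iota 0 4)).

Lemma forall_ord4 (P : pred nat) : [forall i : 'I_4, P i] = allI4 P.
Proof.
apply/forallP/allP => [h i|h i].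
  by rewrite mem_iota /= add0n => i4; exact: (h (Ordinal i4)).
by apply: h; rewrite mem_iota /= add0n.
Qed.

Lemma card_ord4 (P : pred nat) : #|[pred i : 'I_4 | P i]| = count P (iota 0 4).
Proof. by rewrite cardE /enum_mem size_filter -enumT -val_enum_ord count_map. Qed.

(** Equal entries share a rank, so ranks reproduce strict and weak comparisons alike; taking only
    the values 0 to 3, they make the order types enumerable. *)
Definition rank {d : Order.disp_t} {T : orderType d} (u : nat -> T) (i : nat) :=
  count (fun j => (u j < u i)%O) (iota 0 4).

Section Rank.
Variables (d : Order.disp_t) (T : orderType d) (u : nat -> T).

Lemma rank_lt4 i : (i < 4)%N -> (rank u i < 4)%N.
Proof.
move=> i4; rewrite ltnNge; apply/negP => h.
have : all (fun j => (u j < u i)%O) (iota 0 4).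
  by rewrite all_count size_iota eqn_leq h (leq_trans (count_size _ _)) ?size_iota.
by move=> /allP/(_ i); rewrite mem_iota add0n i4 ltxx => /(_ isT).
Qed.

Lemma rank_lt i j : (i < 4)%N -> (rank u i < rank u j)%N = (u i < u j)%O.
Proof.
move=> i4; apply/idP/idP => [|uij].
  apply: contraTT; rewrite -leNgt -leqNgt => uji.
  by apply: sub_count => k /= /lt_le_trans; apply.
(* All entries below [u i] are below [u j], and the index i itself is one more. *)
have <- : (rank u i + count (pred1 i) (iota 0 4) = (rank u i).+1)%N.
  by rewrite count_uniq_mem ?iota_uniq// mem_iota add0n i4 addn1.
rewrite -count_predUI [X in (_ + X)%N](_ : _ = 0%N) ?addn0.
  by apply: sub_count => k /= /orP[/lt_trans|/eqP ->] //; apply.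
apply/eqP; rewrite -leqn0 leqNgt -has_count; apply/hasPn => k _ /=.
by case: eqP => [->|]; rewrite ?ltxx ?andbF.
Qed.

Lemma rank_le i j : (j < 4)%N -> (rank u i <= rank u j)%N = (u i <= u j)%O.
Proof. by move=> j4; rewrite leqNgt rank_lt// leNgt. Qed.

End Rank.

(* In the definitions below, [r] lists the ranks of numbers [u i] in [0, L), and
   the conditions are those on the shifted numbers [t i = u i - L * a i], written
   in terms of [r] and [a] only: [t i <= t j]; all differences in [[-L, L]]; all
   differences in ]-L, L[; and [-L < t i - t j <= L] for [i < j]. *)
Definition shifted_le (r : nat -> nat) (a : nat -> bool) i j :=
  if a i then a j ==> (r i <= r j)%N else ~~ a j && (r i <= r j)%N.

Definition closed_fit (r : nat -> nat) (a : nat -> bool) :=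
  allI4 (fun i => allI4 (fun j => a i && ~~ a j ==> (r j <= r i)%N)).

Definition open_fit (r : nat -> nat) (a : nat -> bool) :=
  allI4 (fun i => allI4 (fun j => a i && ~~ a j ==> (r j < r i)%N)).

Definition halfopen_fit (r : nat -> nat) (a : nat -> bool) :=
  allI4 (fun i => allI4 (fun j => (i < j)%N ==>
    (a i && ~~ a j ==> (r j < r i)%N) && (~~ a i && a j ==> (r i <= r j)%N))).

(** Here p and q count the largest and the smallest shifted numbers, so this is the reciprocal of
    the weight of a boundary point. *)
Definition tie_count (r : nat -> nat) (a : nat -> bool) :=
  let p := count (fun i => allI4 (fun j => shifted_le r a j i)) (iota 0 4) in
  let q := count (fun i => allI4 (fun j => shifted_le r a i j)) (iota 0 4) in
  'C(p + q, p).

(* 12 is a common multiple of the binomials [C(p + q, p)] with [0 < p, q] and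
   [p + q <= 4]. *)
Definition weight12 (r : nat -> nat) (a : nat -> bool) : nat :=
  if closed_fit r a then if open_fit r a then 12 else 12 %/ tie_count r a else 0.

Definition bool3 : seq (bool * bool * bool) :=
  [seq (x, y) | x <- [seq (x, y) | x <- [:: false; true], y <- [:: false; true]],
                y <- [:: false; true]].

Definition wt3 (v : bool * bool * bool) : nat := (v.1.1 + v.1.2 + v.2)%N.

(* As the shifted numbers must sum to 0, three shifts determine the fourth, which
   is [N - wt3 v]; it has to be 0 or 1. *)
Definition completable (N : nat) (v : bool * bool * bool) :=
  (wt3 v <= N <= (wt3 v).+1)%N.

Definition complete (N : nat) (v : bool * bool * bool) : nat -> bool :=
  nth false [:: v.1.1; v.1.2; v.2; (wt3 v < N)%N].

(** The three facts that the tilings require of an order type: weights adding up to 12 twelfths, a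
    unique half-open translate, and exact divisions in [weight12]. *)
Definition shift_check (N : nat) (r : nat -> nat) :=
  [&& sumn [seq (if completable N v then weight12 r (complete N v) else 0)%N
           | v <- bool3] == 12%N,
      sumn [seq nat_of_bool (completable N v && halfopen_fit r (complete N v))
           | v <- bool3] == 1%N
    & all (fun v => [&& completable N v, closed_fit r (complete N v)
                      & ~~ open_fit r (complete N v)] ==>
          (tie_count r (complete N v) %| 12)%N) bool3].

(* Only finitely many order types occur: checked by enumeration. *)
Lemma shift_check_ranks (N : nat) (r : nat -> nat) : (N < 4)%N ->
  (forall i, (i < 4)%N -> (r i < 4)%N) ->
  shift_check N r.
Proof.
move=> N4 r4.
have : allI4 (fun N => allI4 (fun a => allI4 (fun b => allI4 (fun c => allI4 (fun d =>
  shift_check N (nth 0%N [:: a; b; c; d])))))) by vm_compute.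
have at4 (P : pred nat) i : allI4 P -> i < 4 -> P i.
  by move=> /allP h i4; apply: h; rewrite mem_iota.
move=> /at4/(_ N4)/at4/(_ (r4 0 isT))/at4/(_ (r4 1 isT))/at4/(_ (r4 2 isT)).
move=> /at4/(_ (r4 3 isT)).
exact.
Qed.

Local Open Scope ring_scope.

Lemma eq_allI4 (P Q : pred nat) : (forall i, (i < 4)%N -> P i = Q i) -> allI4 P = allI4 Q.
Proof. by move=> PQ; apply: eq_in_all => i; rewrite mem_iota => /PQ. Qed.

Lemma allI4P (P : pred nat) : reflect (forall i, (i < 4)%N -> P i) (allI4 P).
Proof.
by apply: (iffP allP) => h i; [move=> i4; apply: h; rewrite mem_iota|rewrite mem_iota => /h].
Qed.

Lemma allI4_pairP (P : nat -> nat -> bool) :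
  reflect (forall i j, (i < 4)%N -> (j < 4)%N -> P i j) (allI4 (fun i => allI4 (P i))).
Proof.
apply: (iffP (allI4P _)) => [h i j i4 j4|h i i4]; first exact: (allI4P _ (h _ i4)).
by apply/allI4P => j; exact: h.
Qed.

Lemma forall_ord4_pair (P : nat -> nat -> bool) :
  [forall i : 'I_4, forall j : 'I_4, P i j] = allI4 (fun i => allI4 (P i)).
Proof.
rewrite -(forall_ord4 (fun i => allI4 (P i))).
by apply: eq_forallb => i; rewrite (forall_ord4 (P i)).
Qed.

(** [cweight] takes cardinals of classical sets; counts over [iota 0 4] are the form in which
    [tie_count] can be evaluated. *)
Lemma card_forall_ord4 (b c : nat -> nat -> bool) :
    (forall i j, (i < 4)%N -> (j < 4)%N -> c i j = b i j) ->
  #|[set i : 'I_4 | [forall j : 'I_4, c i j]]%classic| =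
  count (fun i => allI4 (b i)) (iota 0 4).
Proof.
move=> cb; rewrite -(card_ord4 (fun i => allI4 (b i))); apply: eq_card => i.
rewrite [RHS]inE; transitivity [forall j : 'I_4, c i j].
  by apply/idP/idP; rewrite inE.
by rewrite (forall_ord4 (c i)); apply: eq_allI4 => j; exact: cb.
Qed.

(** * Comparisons of shifted integers *)

Section IntegerShift.
Variables (L : nat) (u k : nat -> int) (a : nat -> bool).
Hypothesis uL : forall i, (i < 4)%N -> 0 <= u i < L%:Z.
Hypothesis kE : forall i, (i < 4)%N -> k i = u i - L%:Z * (a i)%:Z.

(** As all [u i] lie in [0, L), entries shifted differently compare by their shifts alone, and
    equally shifted ones as before. *)
Lemma shifted_leE i j : (i < 4)%N -> (j < 4)%N ->
  (k i <= k j) = shifted_le (rank u) a i j.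
Proof.
move=> i4 j4; rewrite !kE// /shifted_le !rank_le//.
have := uL i4; have := uL j4.
by case: (a i); case: (a j) => /= /andP[? ?] /andP[? ?]; rewrite ?andbT; lia.
Qed.

(** A difference can exceed L only from a shifted to an unshifted entry, where it is L plus the
    difference of the original values. *)
Lemma closed_fitE : allI4 (fun i => allI4 (fun j =>
    (i < j)%N ==> ((- L%:Z <= k i - k j) && (k i - k j <= L%:Z)))) =
  closed_fit (rank u) a.
Proof.
have E i j : (i < 4)%N -> (j < 4)%N ->
    (k j - k i <= L%:Z) = (a i && ~~ a j ==> (rank u j <= rank u i)%N).
  move=> i4 j4; rewrite !kE// !rank_le//.
  have := uL i4; have := uL j4.
  by case: (a i); case: (a j) => /= /andP[? ?] /andP[? ?]; rewrite ?andbT; lia.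
apply/allI4_pairP/allI4_pairP => h i j i4 j4.
  rewrite -E//; case: (ltngtP i j) => [ij|ij|->]; last by rewrite subrr.
    by move: (h _ _ i4 j4); rewrite ij /=; lia.
  by move: (h _ _ j4 i4); rewrite ij /=; lia.
apply/implyP => ij; move: (h _ _ i4 j4) (h _ _ j4 i4); rewrite -!E//; lia.
Qed.

Lemma open_fitE : allI4 (fun i => allI4 (fun j => k i - k j < L%:Z)) =
  open_fit (rank u) a.
Proof.
have E i j : (i < 4)%N -> (j < 4)%N ->
    (k j - k i < L%:Z) = (a i && ~~ a j ==> (rank u j < rank u i)%N).
  move=> i4 j4; rewrite !kE// !rank_lt//.
  have := uL i4; have := uL j4.
  by case: (a i); case: (a j) => /= /andP[? ?] /andP[? ?]; rewrite ?andbT; lia.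
by apply/allI4_pairP/allI4_pairP => h i j i4 j4; [rewrite -E//|rewrite E//]; exact: h.
Qed.

Lemma tie_countE :
  let p := #|[set i : 'I_4 | [forall j : 'I_4, k j <= k i]]%classic| in
  let q := #|[set i : 'I_4 | [forall j : 'I_4, k i <= k j]]%classic| in
  'C(p + q, p) = tie_count (rank u) a.
Proof.
rewrite /= (card_forall_ord4 (c := fun i j => k j <= k i)
  (b := fun i j => shifted_le (rank u) a j i)); last first.
  by move=> i j i4 j4; exact: shifted_leE.
by rewrite (card_forall_ord4 (c := fun i j => k i <= k j)
  (b := shifted_le (rank u) a))//; exact: shifted_leE.
Qed.

End IntegerShift.

(** * Translates of lattice points and their weights *)

Lemma vec_of3_sum x : \sum_(i < 4) vec_of3 x i = 0.
Proof. by rewrite !big_ord_recl big_ord0 /vec_of3 /=; ring. Qed.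

(** The quadruple of [vec_of3], indexed by [nat] to fit conditions over [iota 0 4]. *)
Definition vec4 (x : int * int * int) : nat -> int :=
  nth 0 [:: x.1.1; x.1.2; x.2; - (x.1.1 + x.1.2 + x.2)].

(** The fourth coordinate is minus the sum of three numbers congruent to some r modulo 4, and -3r is
    congruent to r. *)
Lemma inHlat_vec_of3 (x : int * int * int) :
  inHlat (vec_of3 x) = (4 %| x.1.1 - x.1.2)%Z && (4 %| x.1.1 - x.2)%Z.
Proof.
rewrite /inHlat vec_of3_sum eqxx /=.
transitivity (allI4 (fun i => allI4 (fun j => (4 %| vec4 x i - vec4 x j)%Z))).
  exact: (forall_ord4_pair (fun i j => (4 %| vec4 x i - vec4 x j)%Z)).
by rewrite /vec4 /=; lia.
Qed.

Lemma inHstar_vec_of3 (n : nat) (x : int * int * int) :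
  inHstar n (vec_of3 x) = (4 %| x.1.1 - x.1.2)%Z && (4 %| x.1.1 - x.2)%Z &&
    allI4 (fun i => allI4 (fun j => (i < j)%N ==>
      ((- (4 * n)%:Z <= vec4 x i - vec4 x j) && (vec4 x i - vec4 x j <= (4 * n)%:Z)))).
Proof.
rewrite /inHstar inHlat_vec_of3; congr (_ && _).
exact: (forall_ord4_pair (fun i j => (i < j)%N ==>
  ((- (4 * n)%:Z <= vec4 x i - vec4 x j) && (vec4 x i - vec4 x j <= (4 * n)%:Z)))).
Qed.

Definition cshift (m : nat) (x : int * int * int) (v : bool * bool * bool) : int * int * int :=
  (x.1.1 - m%:Z * v.1.1%:Z, x.1.2 - m%:Z * v.1.2%:Z, x.2 - m%:Z * v.2%:Z).

Section LatticeTiling.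
Variables (R : realType) (n N : nat) (x : int * int * int).
Let L := (4 * n)%N.
(** The four entries sum to [L * N], so a vector of sum 0 arises by lowering N of them by L. *)
Let u := nth 0 [:: x.1.1; x.1.2; x.2; (L * N)%:Z - (x.1.1 + x.1.2 + x.2)].
Hypothesis uL : forall i, (i < 4)%N -> 0 <= u i < L%:Z.
Hypothesis xdvd : (4 %| x.1.1 - x.1.2)%Z && (4 %| x.1.1 - x.2)%Z.

Lemma vec4_cshift v : completable N v -> forall i, (i < 4)%N ->
  vec4 (cshift L x v) i = u i - L%:Z * (complete N v i)%:Z.
Proof.
move=> cNv; rewrite /vec4 /u /complete /cshift.
do 4?[case=> //]; rewrite /= => _.
have -> : (L * N)%:Z = L%:Z * ((v.1.1 + v.1.2 + v.2)%N%:Z + (wt3 v < N)%N%:Z).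
  by rewrite PoszM; congr (_ * _); move: cNv; rewrite /completable /wt3; lia.
by rewrite !PoszD; ring.
Qed.

Lemma inHstar_cshift v : inHstar n (vec_of3 (cshift L x v)) =
  completable N v && closed_fit (rank u) (complete N v).
Proof.
rewrite inHstar_vec_of3.
rewrite [X in X && _](_ : _ = true); last first.
  by move: xdvd; rewrite /L; case: v => [[[] []] []] /=; lia.
rewrite !andTb; have [cNv|ncNv] := boolP (completable N v).
  by rewrite (closed_fitE uL (vec4_cshift cNv)).
rewrite [RHS]/=.
(* If the fourth shift is negative, the last coordinate is at least L while some shifted one is
   negative. If it exceeds 1, the last coordinate is below -L while some unshifted one is
   nonnegative. Either way a difference exceeds L. *)
apply: negbTE; apply: contra ncNv => /allI4_pairP h.
move: (h 0%N 3%N isT isT) (h 1%N 3%N isT isT) (h 2%N 3%N isT isT).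
move: (@uL 0%N isT) (@uL 1%N isT) (@uL 2%N isT) (@uL 3%N isT).
rewrite /completable /wt3 /vec4 /u /cshift /= -/L.
case: v {h} => [[[] []] []] /=; nia.
Qed.

Lemma cweight_cshift v : shift_check N (rank u) -> v \in bool3 ->
  (if inHstar n (vec_of3 (cshift L x v)) then cweight R n (vec_of3 (cshift L x v)) else 0) =
  (if completable N v then weight12 (rank u) (complete N v) else 0)%N%:R / 12%:R :> R.
Proof.
move=> /and3P[_ _ /allP h] vb; rewrite inHstar_cshift.
have [cNv|ncNv] /= := boolP (completable N v); last by rewrite mul0r.
rewrite /weight12; case: ifP => [cf|_]; last by rewrite mul0r.
move: (h v vb); rewrite cNv cf /= => {h}.
have kE := vec4_cshift cNv.
have := open_fitE uL kE; have := tie_countE uL kE.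
rewrite -(forall_ord4_pair (fun i j => vec4 (cshift L x v) i - vec4 (cshift L x v) j < L%:Z)).
rewrite /cweight => tE oE.
rewrite (_ : [forall i, _] = open_fit (rank u) (complete N v)); last exact: oE.
case: ifP => _ /=; first by rewrite divff// pnatr_eq0.
(* The third part of [shift_check] makes [12 %/ tie_count] a true quotient. *)
move=> d12; rewrite -[X in X^-1 = _]/(_%:R).
rewrite (_ : 'C(_, _) = tie_count (rank u) (complete N v)); last exact: tE.
have t0 : (tie_count (rank u) (complete N v) != 0)%N.
  by apply: contraTneq d12 => ->.
apply: (mulIf (x := 12%:R)); first by rewrite pnatr_eq0.
rewrite divfK ?pnatr_eq0//.
rewrite -[in LHS](divnK d12) natrM mulrCA mulVf ?mulr1// pnatr_eq0//.
Qed.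

Lemma cweight_cshift_sum : shift_check N (rank u) ->
  \sum_(v <- bool3) (if inHstar n (vec_of3 (cshift L x v)) then
    cweight R n (vec_of3 (cshift L x v)) else 0) = 1 :> R.
Proof.
move=> ch; rewrite (eq_big_seq _ (fun v vb => cweight_cshift ch vb)).
rewrite -mulr_suml -natr_sum.
have /and3P[/eqP + _ _] := ch; rewrite sumnE big_map => ->.
by rewrite divff// pnatr_eq0.
Qed.

End LatticeTiling.

Lemma cweight_tiling (R : realType) (n : nat) (x : int * int * int) : (0 < n)%N ->
  0 <= x.1.1 < (4 * n)%:Z -> 0 <= x.1.2 < (4 * n)%:Z -> 0 <= x.2 < (4 * n)%:Z ->
  (4 %| x.1.1 - x.1.2)%Z && (4 %| x.1.1 - x.2)%Z ->
  \sum_(v <- bool3) (if inHstar n (vec_of3 (cshift (4 * n) x v)) then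
    cweight R n (vec_of3 (cshift (4 * n) x v)) else 0) = 1 :> R.
Proof.
move=> n0 x1 x2 x3 xdvd.
(* N is the ceiling of the sum of the three coordinates over 4n; it is at most 3 since each
   coordinate is below 4n. *)
have [N N4 NE] : exists2 N : nat, (N < 4)%N &
    0 <= (4 * n * N)%:Z - (x.1.1 + x.1.2 + x.2) < (4 * n)%:Z.
  move: x1 x2 x3 => /andP[? ?] /andP[? ?] /andP[? ?].
  have [?|?] := leP (x.1.1 + x.1.2 + x.2) 0; first by exists 0%N => //; lia.
  have [?|?] := leP (x.1.1 + x.1.2 + x.2) (4 * n)%:Z; first by exists 1%N => //; lia.
  have [?|?] := leP (x.1.1 + x.1.2 + x.2) (4 * n * 2)%:Z; first by exists 2%N => //; lia.
  by exists 3%N => //; lia.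
apply: (cweight_cshift_sum R (N := N)) => //; first by do 4?[case=> //].
by apply: shift_check_ranks => // i; exact: rank_lt4.
Qed.

(** * Translates of points of the hyperplane *)

Section RealTiling.
Variable R : realType.

Definition tshift (x : R * R * R) (v : bool * bool * bool) : R * R * R :=
  (x.1.1 - (v.1.1 : nat)%:R, x.1.2 - (v.1.2 : nat)%:R, x.2 - (v.2 : nat)%:R).

Definition emb4 (x : R * R * R) : nat -> R :=
  nth 0 [:: x.1.1; x.1.2; x.2; - (x.1.1 + x.1.2 + x.2)].

Lemma embH_sum (x : R * R * R) : inRH (embH x).
Proof. by rewrite /inRH !big_ord_recl big_ord0 /embH /=; ring. Qed.

Lemma inOmegaH_embHP (x : R * R * R) : reflect (inOmegaH (embH x))
  (allI4 (fun i => allI4 (fun j => (i < j)%N ==> (-1 < emb4 x i - emb4 x j <= 1)))).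
Proof.
apply: (iffP (allI4_pairP _)) => [h|[_ h] i j i4 j4].
  by split=> [|i j ij]; [exact: embH_sum|exact: (implyP (h _ _ (ltn_ord i) (ltn_ord j)))].
by apply/implyP => ij; exact: (h (Ordinal i4) (Ordinal j4)).
Qed.

Variables (N : nat) (x : R * R * R).
Let u := nth 0 [:: x.1.1; x.1.2; x.2; N%:R - (x.1.1 + x.1.2 + x.2)].
Hypothesis u01 : forall i, (i < 4)%N -> 0 <= u i < 1.

Lemma emb4_tshift v : completable N v -> forall i, (i < 4)%N ->
  emb4 (tshift x v) i = u i - (complete N v i : nat)%:R.
Proof.
move=> cNv; rewrite /emb4 /u /complete /tshift.
do 4?[case=> //]; rewrite /= => _.
have -> : N%:R = (v.1.1 + v.1.2 + v.2 + (wt3 v < N))%N%:R :> R.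
  by congr (_%:R); move: cNv; rewrite /completable /wt3; lia.
by rewrite !natrD; ring.
Qed.

Lemma inOmegaH_tshift v : `[< inOmegaH (embH (tshift x v)) >] =
  completable N v && halfopen_fit (rank u) (complete N v).
Proof.
rewrite (asbool_equiv_eq (rwP (inOmegaH_embHP _))) asboolb.
have [cNv|ncNv] := boolP (completable N v); rewrite ?[RHS]/=.
  have kE := emb4_tshift cNv.
  apply: eq_allI4 => i i4; apply: eq_allI4 => j j4; congr (_ ==> _).
  rewrite !kE// rank_lt// rank_le//; move: (u01 i4) (u01 j4).
  by case: (complete N v i); case: (complete N v j) => /= /andP[? ?] /andP[? ?];
    rewrite ?andbT; apply/idP/idP; lra.
(* As for lattice points, a fourth shift other than 0 or 1 pushes the last coordinate more than 1
   away from another one. *)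
apply: negbTE; apply: contra ncNv => /allI4_pairP h.
move: (h 0%N 3%N isT isT) (h 1%N 3%N isT isT) (h 2%N 3%N isT isT) => {h}.
move: (@u01 0%N isT) (@u01 1%N isT) (@u01 2%N isT) (@u01 3%N isT).
rewrite /completable /wt3 /emb4 /u /tshift /=.
move=> /andP[? ?] /andP[? ?] /andP[? ?] /andP[? ?] h0 h1 h2.
apply/andP; split; rewrite leqNgt; apply/negP; rewrite -(ler_nat R).
  by case: v h0 h1 h2 => [[[] []] []] /= /andP[? ?] /andP[? ?] /andP[? ?];
    rewrite -?natr1; lra.
by case: v h0 h1 h2 => [[[] []] []] /= /andP[? ?] /andP[? ?] /andP[? ?];
  rewrite -?natr1; lra.
Qed.

Lemma indic_tiling_rank : shift_check N (rank u) ->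
  (\sum_(v <- bool3) `[< inOmegaH (embH (tshift x v)) >])%N = 1%N.
Proof.
move=> /and3P[_ /eqP <- _]; rewrite sumnE big_map; apply: eq_bigr => v _.
by rewrite inOmegaH_tshift.
Qed.
End RealTiling.

Lemma indic_tiling (R : realType) (x : R * R * R) :
  0 <= x.1.1 < 1 -> 0 <= x.1.2 < 1 -> 0 <= x.2 < 1 ->
  (\sum_(v <- bool3) `[< inOmegaH (embH (tshift x v)) >])%N = 1%N.
Proof.
move=> x1 x2 x3.
have [N N4 NE] : exists2 N : nat, (N < 4)%N & 0 <= N%:R - (x.1.1 + x.1.2 + x.2) < 1.
  move: x1 x2 x3 => /andP[? ?] /andP[? ?] /andP[? ?].
  have [?|?] := leP (x.1.1 + x.1.2 + x.2) 0; first by exists 0%N => //; lra.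
  have [?|?] := leP (x.1.1 + x.1.2 + x.2) 1; first by exists 1%N => //; lra.
  have [?|?] := leP (x.1.1 + x.1.2 + x.2) 2; first by exists 2%N => //; lra.
  by exists 3%N => //; lra.
apply: (indic_tiling_rank (N := N)); first by do 4?[case=> //].
by apply: shift_check_ranks => // i; exact: rank_lt4.
Qed.

(** * Integration over fundamental domains *)

Section MeasurePreserving.
Local Open Scope classical_set_scope.
Local Open Scope ereal_scope.

Definition preserves d (T : measurableType d) (R : realType) (mu : set T -> \bar R)
    (f : T -> T) :=
  measurable_fun setT f /\ forall A, measurable A -> pushforward mu f A = mu A.

(** Half-open intervals determine Lebesgue measure, and translations preserve their lengths. *)
Lemma preserves_lebesgue_shift (R : realType) (c : R) :
  preserves (@lebesgue_measure R) (fun x => x - c)%R.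
Proof.
have mf : measurable_fun setT (fun x : measurableTypeR R => (x - c)%R : measurableTypeR R).
  exact: measurable_funD.
split=> // A mA; apply/esym.
apply: lebesgue_measure_unique => // _ [[a b]] _ <-.
rewrite [RHS]/= /pushforward (_ : _ @^-1` _ = `](a + c)%R, (b + c)%R]%classic); last first.
  by rewrite !set_itvE; apply/seteqP; split => y /=; rewrite ltrBrDr lerBlDr.
by rewrite !lebesgue_measure_itv/= !lte_fin ltrD2r -!EFinB opprD addrACA subrr addr0.
Qed.

(** By uniqueness of the product measure it suffices to look at rectangles. *)
Lemma preserves_prod d1 d2 (T1 : measurableType d1) (T2 : measurableType d2)
    (R : realType) (m1 : {sigma_finite_measure set T1 -> \bar R})
    (m2 : {sigma_finite_measure set T2 -> \bar R}) (f1 : T1 -> T1) (f2 : T2 -> T2) :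
  preserves m1 f1 -> preserves m2 f2 ->
  preserves (product_measure1 m1 m2) (fun x => (f1 x.1, f2 x.2)).
Proof.
move=> [mf1 p1] [mf2 p2].
have mf : measurable_fun setT (fun x : T1 * T2 => (f1 x.1, f2 x.2)).
  by apply/measurable_fun_pairP; split;
    [exact: (measurableT_comp mf1 measurable_fst)|exact: (measurableT_comp mf2 measurable_snd)].
split=> // A mA; apply/esym/product_measure_unique => // B C mB mC.
rewrite [LHS]/= -p1// -p2// /pushforward -product_measure1E//.
  by rewrite -[X in measurable X]setTI; exact: mf1.
by rewrite -[X in measurable X]setTI; exact: mf2.
Qed.

(* [product_measure1] is canonically sigma-finite only for subprobabilities, hence this
   alias of the planar Lebesgue measure. *)
Definition leb2 (R : realType) : set (measurableTypeR R * measurableTypeR R) -> \bar R :=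
  product_measure1 (@lebesgue_measure R) (@lebesgue_measure R).

HB.instance Definition _ (R : realType) := Measure.on (@leb2 R).

Lemma leb2_sigma_finite (R : realType) : sigma_finite setT (@leb2 R).
Proof.
exists (fun n => `[- n%:R, n%:R]%classic `*` `[- n%:R, n%:R]%classic)%R => [|n].
  apply/esym; rewrite -subTset => -[x y] _.
  pose t : R := Num.max `|x : R|%R `|y : R|%R.
  have : (t <= (Num.truncn t).+1%:R)%R by apply: ltW; exact: truncnS_gt.
  exists (Num.truncn t).+1 => //=; rewrite !in_itv /= -!ler_norml.
  by apply/andP; rewrite -ge_max.
split; first by apply: measurableX; exact: measurable_itv.
rewrite [ltLHS]product_measure1E; [|exact: measurable_itv|exact: measurable_itv].
have fin : lebesgue_measure `[(- n%:R)%R, n%:R%R]%classic < +oo :> \bar R.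
  by rewrite lebesgue_measure_itv /=; case: ifP; rewrite // -EFinD ltry.
by rewrite lte_mul_pinfty// ge0_fin_numE.
Qed.

HB.instance Definition _ (R : realType) :=
  Measure_isSigmaFinite.Build _ _ _ (@leb2 R) (@leb2_sigma_finite R).

HB.instance Definition _ (R : realType) := Measure.on (@leb3 R).

Lemma preserves_leb3_shift (R : realType) (a b c : R) :
  preserves (@leb3 R) (fun x => (x.1.1 - a, x.1.2 - b, x.2 - c))%R.
Proof.
have p2 : preserves (@leb2 R) (fun x => (x.1 - a, x.2 - b))%R.
  exact: (preserves_prod (preserves_lebesgue_shift a) (preserves_lebesgue_shift b)).
exact: (preserves_prod p2 (preserves_lebesgue_shift c)).
Qed.

Lemma ge0_integral_preserves d (T : measurableType d) (R : realType)
    (mu : {measure set T -> \bar R}) (f : T -> T) (g : T -> \bar R) :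
  preserves mu f -> measurable_fun setT g -> (forall x, 0 <= g x) ->
  \int[mu]_x g (f x) = \int[mu]_x g x.
Proof.
move=> [mf pf] mg g0.
transitivity (\int[pushforward mu f]_x g x); first by rewrite ge0_integral_pushforward.
apply: eq_measure_integral => A mA _; exact: pf.
Qed.

Lemma integral_indicM d (T : measurableType d) (R : realType)
    (mu : {measure set T -> \bar R}) (A : set T) (g : T -> R) :
  \int[mu]_(x in A) (g x)%:E = \int[mu]_x (g x * (x \in A)%:R)%:E.
Proof.
rewrite integral_mkcond; apply: eq_integral => x _; rewrite /patch.
by case: ifP => _; rewrite ?mulr1 ?mulr0.
Qed.

(* Both sides sum up the integrals of [g] over the pieces of [D] cut out by the
   translates of [B]. *)
Lemma ge0_integral_tiling d (T : measurableType d) (R : realType)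
    (mu : {measure set T -> \bar R}) (I : Type) (s : seq I) (f f' : I -> T -> T)
    (D B : set T) (g : T -> R) :
  measurable D -> measurable B -> measurable_fun setT g -> (forall x, 0 <= g x)%R ->
  (forall i, preserves mu (f i)) -> (forall i, measurable_fun setT (f' i)) ->
  (forall i, cancel (f i) (f' i)) -> (forall i x, g (f i x) = g x) ->
  (forall x, D x -> \sum_(i <- s) (f' i x \in B) = 1)%N ->
  (forall x, B x -> \sum_(i <- s) (f i x \in D) = 1)%N ->
  \int[mu]_(x in D) (g x)%:E = \int[mu]_(x in B) (g x)%:E.
Proof.
move=> mD mB mg g0 pf mf' fK gf sD sB.
have mI (A : set T) (h : T -> T) : measurable A -> measurable_fun setT h ->
    measurable_fun setT (fun x => (h x \in A)%:R : R).
  move=> mA mh.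
  have m1 : measurable_fun setT (\1_A : T -> R) by exact: measurable_indic.
  exact: (measurableT_comp m1 mh).
rewrite (integral_indicM mu D) (integral_indicM mu B).
transitivity (\sum_(i <- s) \int[mu]_x (g x * (x \in D)%:R * (f' i x \in B)%:R)%:E).
  rewrite -ge0_integral_sum//.
  - apply: eq_integral => x _; rewrite sumEFin -mulr_sumr -natr_sum; congr EFin.
    by case: (boolP (x \in D)) => [|_]; [rewrite inE => /sD ->|]; rewrite ?mulr0 ?mulr1 ?mul0r.
  - move=> i; apply/measurable_EFinP; apply: measurable_funM; last exact: mI.
    by apply: measurable_funM => //; exact: (mI _ id).
  - by move=> i x _; rewrite lee_fin !mulr_ge0.
transitivity (\sum_(i <- s) \int[mu]_x (g x * (x \in B)%:R * (f i x \in D)%:R)%:E).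
  (* Substituting [f i x] for x in the i-th integral moves the translation from the indicator of B
     to that of D. *)
  apply: eq_bigr => i _; rewrite -(ge0_integral_preserves (pf i)).
  - by apply: eq_integral => x _; rewrite fK gf mulrAC.
  - apply/measurable_EFinP; apply: measurable_funM; last exact: mI.
    by apply: measurable_funM => //; exact: (mI _ id).
  - by move=> x; rewrite lee_fin !mulr_ge0.
rewrite -ge0_integral_sum//.
- apply: eq_integral => x _; rewrite sumEFin -mulr_sumr -natr_sum; congr EFin.
  by case: (boolP (x \in B)) => [|_]; [rewrite inE => /sB ->|]; rewrite ?mulr0 ?mulr1 ?mul0r.
- move=> i; apply/measurable_EFinP; apply: measurable_funM; last by apply: mI; have [] := pf i.
  by apply: measurable_funM => //; exact: (mI _ id).
- by move=> i x _; rewrite lee_fin !mulr_ge0.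
Qed.

End MeasurePreserving.

Local Open Scope classical_set_scope.
Local Open Scope ring_scope.

Lemma ge0_integral_setX d1 d2 (T1 : measurableType d1) (T2 : measurableType d2)
    (R : realType) (m1 : {sigma_finite_measure set T1 -> \bar R})
    (m2 : {sigma_finite_measure set T2 -> \bar R}) (A : set T1) (C : set T2)
    (g : T1 * T2 -> R) :
  measurable A -> measurable C -> measurable_fun setT g -> (forall x, 0 <= g x) ->
  (\int[product_measure1 m1 m2]_(x in A `*` C) (g x)%:E =
   \int[m1]_(x in A) \int[m2]_(y in C) (g (x, y))%:E)%E.
Proof.
move=> mA mC mg g0.
have mAC : measurable (A `*` C) by exact: measurableX.
rewrite (integral_indicM (product_measure1 m1 m2)) fubini_tonelli1; last 2 first.
- apply/measurable_EFinP; apply: measurable_funM => //.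
  have m1AC : measurable_fun setT (\1_(A `*` C) : T1 * T2 -> R) by exact: measurable_indic.
  exact: m1AC.
- by move=> x; rewrite lee_fin mulr_ge0.
rewrite [RHS]integral_mkcond; apply: eq_integral => x _.
rewrite /fubini_F /patch; case: ifPn => xA; last first.
  apply: integral0_eq => y _; rewrite (_ : (x, y) \in A `*` C = false) ?mulr0//.
  by apply: contraNF xA; rewrite !inE => -[].
rewrite (integral_indicM m2 C); apply: eq_integral => y _; congr (_ * _%:R)%:E.
congr nat_of_bool; apply/idP/idP; rewrite !inE; first by case.
by move=> yC; split => //; exact: set_mem.
Qed.

(** * One-dimensional integrals of cosines *)

Section Cosine.
Variable R : realType.
Implicit Types (m : int) (c del : R).

(** With [K = del / w] this gives the primitive of [1 + del * cos (w * x + c)] for a nonzero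
    frequency. *)
Lemma is_derive_id_sin (K w c x : R) :
  is_derive x 1 (fun z : R => z + K * sin (w * z + c)) (1 + K * (w * cos (w * x + c))).
Proof.
have -> : (fun z : R => z + K * sin (w * z + c)) =
    id + K \*: (sin \o (w \*: id + cst c)) by [].
apply: is_derive_eq; rewrite addr0 /GRing.scale /= mulr1.
by rewrite [w * cos _]mulrC.
Qed.

Lemma integral_01_primitive (f F : R -> R) : (forall x : R, is_derive x 1 F (f x)) ->
  continuous f ->
  (\int[lebesgue_measure]_(x in `[0%R, 1%R[) (f x)%:E = (F 1 - F 0)%:E)%E.
Proof.
move=> dF cf.
rewrite integral_itv_bndo_bndc; last first.
  by apply/measurable_EFinP/measurable_funTS; exact: continuous_measurable_fun.
rewrite (continuous_FTC2 (F := F)) ?EFinB//.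
- exact: continuous_subspaceT.
- have dF' x : derivable F x 1 by have [] := dF x.
  have cF x : {for x, continuous F} by apply/differentiable_continuous/derivable1_diffP.
  split => //; first by apply/cvg_at_right_filter/cF.
  by apply/cvg_at_left_filter/cF.
- by move=> x _; rewrite derive1E; have [_ ->] := dF x.
Qed.

Lemma cosD_int (x : R) m : cos (x + 2 * pi * m%:~R) = cos x.
Proof.
have H (y : R) (k : nat) : cos (y + 2 * pi * k%:R) = cos y.
  elim: k => [|k IH]; first by rewrite mulr0 addr0.
  rewrite -IH -(natr1 k) mulrDr mulr1 addrA.
  by rewrite (_ : 2 * pi = pi *+ 2) ?cosD2pi// mulr2n mulrDl mul1r.
case: m => k; first exact: H.
by rewrite NegzE -[LHS](H _ k.+1) mulrNz mulrN subrK.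
Qed.

Lemma sinD_int (x : R) m : sin (x + 2 * pi * m%:~R) = sin x.
Proof. by rewrite -!cosBpihalf addrAC cosD_int. Qed.

(** The shape [1 + del * cos] is nonnegative for [del] in [0, 1], which allows Tonelli's theorem,
    and it is stable: integrating one coordinate only multiplies [del] by 0 or 1, so the computation
    can be iterated. *)
Lemma integral_01_cos m del c :
  (\int[lebesgue_measure]_(x in `[0%R, 1%R[) (1 + del * cos (2 * pi * m%:~R * x + c))%:E =
   (1 + del * ((m == 0)%:R * cos c))%:E)%E.
Proof.
have cf : continuous (fun x : R => 1 + del * cos (2 * pi * m%:~R * x + c)).
  have -> : (fun x : R => 1 + del * cos (2 * pi * m%:~R * x + c)) =
    cst 1 + del \*: (cos \o ((2 * pi * m%:~R) \*: id + cst c)) by [].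
  by move=> x; apply/differentiable_continuous/derivable1_diffP; exact: ex_derive.
have [m0|m0] := eqVneq m 0.
  have dF (x : R) : is_derive x 1 (fun z : R => z + del * cos c * z)
      (1 + del * cos (2 * pi * m%:~R * x + c)).
    have -> : (fun z : R => z + del * cos c * z) = id + (del * cos c) \*: id by [].
    by apply: is_derive_eq; rewrite m0 mulr0 mul0r add0r /GRing.scale /= mulr1.
  by rewrite (integral_01_primitive dF cf) mul1r; congr EFin; ring.
have w0 : 2 * pi * m%:~R != 0 :> R.
  by rewrite !mulf_neq0 ?pnatr_eq0 ?intr_eq0 ?(gt_eqF (pi_gt0 R)).
have dF (x : R) : is_derive x 1
    (fun z : R => z + del / (2 * pi * m%:~R) * sin (2 * pi * m%:~R * z + c))
    (1 + del * cos (2 * pi * m%:~R * x + c)).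
  have := is_derive_id_sin (del / (2 * pi * m%:~R)) (2 * pi * m%:~R) c x.
  by rewrite [_ / _ * (_ * _)]mulrA divfK.
rewrite (integral_01_primitive dF cf); congr EFin.
by rewrite mulr1 mulr0 !add0r mul0r mulr0 [_ + c]addrC sinD_int; ring.
Qed.

End Cosine.

(** * Cosines integrated over Omega_H *)

Section Omega.
Variable R : realType.
Implicit Types (x : R * R * R) (v : bool * bool * bool).

Definition OmegaH3 : set (R * R * R) := [set x | inOmegaH (embH x)].

Definition cube3 : set (R * R * R) := `[0, 1[ `*` `[0, 1[ `*` `[0, 1[.

Definition tunshift x v : R * R * R :=
  (x.1.1 + (v.1.1 : nat)%:R, x.1.2 + (v.1.2 : nat)%:R, x.2 + (v.2 : nat)%:R).

Lemma tshiftK v : cancel (fun x => tshift x v) (fun x => tunshift x v).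
Proof. by move=> [[a b] c]; rewrite /tunshift /= !subrK. Qed.

Lemma mem_cube3 x : (x \in cube3) = [&& 0 <= x.1.1 < 1, 0 <= x.1.2 < 1 & 0 <= x.2 < 1].
Proof.
apply/idP/idP; rewrite inE /cube3 /= !in_itv /=.
  by move=> [[-> ->] ->].
by move=> /and3P[? ? ?]; split; first split.
Qed.

(** As the coordinates sum to 0, four times one of them is the sum of its three differences with the
    others, each at most 1 in absolute value. *)
Lemma OmegaH3_bounded x : OmegaH3 x ->
  [/\ -1 < x.1.1 < 1, -1 < x.1.2 < 1 & -1 < x.2 < 1].
Proof.
move=> /inOmegaH_embHP /allI4_pairP h.
move: (h 0%N 1%N isT isT) (h 0%N 2%N isT isT) (h 0%N 3%N isT isT)
      (h 1%N 2%N isT isT) (h 1%N 3%N isT isT) (h 2%N 3%N isT isT).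
rewrite /emb4 /= => /andP[? ?] /andP[? ?] /andP[? ?] /andP[? ?] /andP[? ?] /andP[? ?].
by split; apply/andP; split; lra.
Qed.

(** The translate in the cube is found by adding 1 to exactly the negative coordinates. *)
Lemma cube3_tiling x : OmegaH3 x ->
  (\sum_(v <- bool3) (tunshift x v \in cube3) = 1)%N.
Proof.
move=> /OmegaH3_bounded[h1 h2 h3].
have E (y : R) (b : bool) : -1 < y < 1 -> (0 <= y + (b : nat)%:R < 1) = (b == (y < 0)).
  move=> /andP[? ?]; have [y0|y0] := ltP y 0; case: b => /=.
  - by apply/andP; split; lra.
  - by apply/negbTE/negP => /andP[? ?]; lra.
  - by apply/negbTE/negP => /andP[? ?]; lra.
  - by apply/andP; split; lra.
transitivity (\sum_(v <- bool3) [&& v.1.1 == (x.1.1 < 0)%R, v.1.2 == (x.1.2 < 0)%R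
    & v.2 == (x.2 < 0)%R])%N.
  by apply: eq_bigr => v _; rewrite mem_cube3 /= !E.
rewrite /bool3 /= !big_cons big_nil /=.
by case: (_ < 0); case: (_ < 0); case: (_ < 0).
Qed.

Lemma preserves_leb3_tshift v : preserves (@leb3 R) (fun x => tshift x v).
Proof. exact: preserves_leb3_shift. Qed.

Local Notation R3 := (measurableTypeR R * measurableTypeR R * measurableTypeR R)%type.

Lemma measurable_tunshift v : measurable_fun setT ((fun x => tunshift x v) : R3 -> R3).
Proof.
have [+ _] := preserves_leb3_shift (- (v.1.1 : nat)%:R) (- (v.1.2 : nat)%:R)
  (- (v.2 : nat)%:R : R).
by congr measurable_fun; apply/funext => x; rewrite /= !opprK.
Qed.

Lemma measurable_cube3 : measurable (cube3 : set R3).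
Proof. by apply: measurableX; first apply: measurableX; exact: measurable_itv. Qed.

Lemma measurable_coord1 : measurable_fun setT ((fun x => x.1.1) : R3 -> R).
Proof. exact: (measurableT_comp measurable_fst measurable_fst). Qed.

Lemma measurable_coord2 : measurable_fun setT ((fun x => x.1.2) : R3 -> R).
Proof. exact: (measurableT_comp measurable_snd measurable_fst). Qed.

Lemma measurable_coord3 : measurable_fun setT ((fun x => x.2) : R3 -> R).
Proof. exact: measurable_snd. Qed.

Lemma measurable_emb4 (i : nat) : measurable_fun setT ((fun x => emb4 x i) : R3 -> R).
Proof.
case: i => [|[|[|[|i]]]].
- exact: measurable_coord1.
- exact: measurable_coord2.
- exact: measurable_coord3.
- apply: measurableT_comp => //; apply: measurable_funD; last exact: measurable_coord3.
  by apply: measurable_funD; [exact: measurable_coord1|exact: measurable_coord2].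
rewrite (_ : (fun x => _) = cst 0); first exact: measurable_cst.
by apply/funext => x; rewrite /emb4 /= nth_nil.
Qed.

Lemma measurable_OmegaH3 : measurable (OmegaH3 : set R3).
Proof.
have -> : OmegaH3 = \bigcap_(i in [set: 'I_4]) \bigcap_(j in [set j : 'I_4 | (i < j)%N])
    [set x : R * R * R | emb4 x i - emb4 x j \in `]-1, 1]].
  apply/seteqP; split => [x [_ h] i _ j ij|x h]; first exact: (h i j ij).
  by split => [|i j ij]; [exact: embH_sum|exact: (h i I j ij)].
apply: fin_bigcap_measurable => [|i _]; first exact: finite_finset.
apply: fin_bigcap_measurable => [|j _]; first exact: finite_finset.
rewrite -[X in measurable X]setTI.
have := measurable_funB (measurable_emb4 i) (measurable_emb4 j).
by move=> /(_ measurableT `]-1, 1]%classic (measurable_itv _)).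
Qed.

(** Nested so that, integrating the last coordinate first, the remaining summands act as the
    constant of [integral_01_cos]. The free [c] also expresses sines, through c = -pi/2. *)
Definition phase (m1 m2 m3 : int) (c : R) x : R :=
  2 * pi * m3%:~R * x.2 + (2 * pi * m2%:~R * x.1.2 + (2 * pi * m1%:~R * x.1.1 + c)).

Lemma sin_phase m1 m2 m3 x :
  sin (phase m1 m2 m3 0 x) = cos (phase m1 m2 m3 (- (pi / 2)) x).
Proof. by rewrite -cosBpihalf; congr cos; rewrite /phase; ring. Qed.

Lemma measurable_phase m1 m2 m3 c :
  measurable_fun setT (phase m1 m2 m3 c : R3 -> R).
Proof.
have mZ (k : R) (f : R3 -> R) : measurable_fun setT f -> measurable_fun setT (fun x => k * f x).
  by move=> mf; apply: measurable_funM => //; exact: measurable_cst.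
do ?[apply: measurable_funD]; try exact: measurable_cst; apply: mZ.
- exact: measurable_coord3.
- exact: measurable_coord2.
- exact: measurable_coord1.
Qed.

Lemma cos_phase_tshift m1 m2 m3 c x v :
  cos (phase m1 m2 m3 c (tshift x v)) = cos (phase m1 m2 m3 c x).
Proof.
rewrite -(cosD_int _ (m1 * v.1.1 + m2 * v.1.2 + m3 * v.2)); congr cos.
by rewrite /phase /tshift /= !rmorphD !rmorphM /= !pmulrn; ring.
Qed.

Lemma integral_OmegaH3_cos m1 m2 m3 c del : 0 <= del <= 1 ->
  (\int[@leb3 R]_(x in OmegaH3) (1 + del * cos (phase m1 m2 m3 c x))%:E =
   (1 + del * (((m1 == 0) && (m2 == 0) && (m3 == 0))%:R * cos c))%:E)%E.
Proof.
move=> /andP[del0 del1].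
have g0 (d t : R) : 0 <= d -> d <= 1 -> 0 <= 1 + d * cos t.
  by move=> ? ?; have := cos_geN1 t; have := cos_le1 t; nra.
have mcos (d1 : measure_display) (T : measurableType d1) (d : R) (f : T -> R) :
    measurable_fun setT f -> measurable_fun setT (fun z : T => 1 + d * cos (f z)).
  move=> mf; apply: measurable_funD; first exact: measurable_cst.
  apply: measurable_funM; first exact: measurable_cst.
  by apply: measurableT_comp mf; apply: continuous_measurable_fun; exact: continuous_cos.
have mphase := measurable_phase m1 m2 m3 c.
(* Invariance under integer shifts allows replacing Omega_H by the cube. *)
transitivity (\int[@leb3 R]_(x in cube3) (1 + del * cos (phase m1 m2 m3 c x))%:E)%E.
  apply: (ge0_integral_tiling (mu := @leb3 R) (s := bool3) (f := fun v x => tshift x v)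
    (f' := fun v x => tunshift x v)).
  - exact: measurable_OmegaH3.
  - exact: measurable_cube3.
  - exact: mcos mphase.
  - by move=> x; exact: g0.
  - exact: preserves_leb3_tshift.
  - exact: measurable_tunshift.
  - exact: tshiftK.
  - by move=> v x; rewrite cos_phase_tshift.
  - exact: cube3_tiling.
  - move=> x xc; have : x \in cube3 by rewrite inE.
    rewrite mem_cube3 => /and3P[h1 h2 h3]; rewrite -[RHS](indic_tiling h1 h2 h3).
    by apply: eq_bigr => v _; congr nat_of_bool; apply/idP/asboolP; rewrite inE.
have mI : measurable (`[0, 1[%classic : set (measurableTypeR R)) by exact: measurable_itv.
(* Integrating the third coordinate turns [del] into [del * (m3 == 0)%:R]; the second coordinate
   follows in the same way. *)
transitivity (\int[@leb2 R]_(y in `[0%R, 1%R[ `*` `[0%R, 1%R[)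
    (1 + del * (m3 == 0)%:R * cos (2 * pi * m2%:~R * y.2 +
       (2 * pi * m1%:~R * y.1 + c)))%:E)%E.
  rewrite [LHS](ge0_integral_setX (@leb2 R) (@lebesgue_measure R)) //; last 3 first.
  - exact: measurableX.
  - exact: mcos mphase.
  - by move=> x; exact: g0.
  by apply: eq_integral => y _; rewrite /phase /= integral_01_cos mulrA.
transitivity (\int[@lebesgue_measure R]_(y in `[0%R, 1%R[)
    (1 + del * (m3 == 0)%:R * (m2 == 0)%:R * cos (2 * pi * m1%:~R * y + c))%:E)%E.
  rewrite [LHS](ge0_integral_setX (@lebesgue_measure R) (@lebesgue_measure R)) //; last 2 first.
  - apply: mcos; do ?[apply: measurable_funD]; try exact: measurable_cst;
      apply: measurable_funM; try exact: measurable_cst;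
      exact: measurable_snd || exact: measurable_fst.
  - by move=> y; apply: g0; case: (m3 == 0); rewrite ?mulr1 ?mulr0.
  by apply: eq_integral => y _; rewrite /= integral_01_cos mulrA.
rewrite integral_01_cos; congr EFin.
by case: (m1 == 0); case: (m2 == 0); case: (m3 == 0); rewrite /=; ring.
Qed.

End Omega.

(** * Integrals of complex-valued functions *)

Section ComplexIntegral.
Variable R : realType.
Local Notation mu := (@leb3 R).
Local Notation OmegaH3 := (@OmegaH3 R).
Local Notation R3 := (measurableTypeR R * measurableTypeR R * measurableTypeR R)%type.

(** The case [del = 0] of the cosine integral. Finiteness then makes bounded measurable functions
    integrable. *)
Lemma leb3_OmegaH3 : (mu OmegaH3 = 1)%E.
Proof.
have := integral_OmegaH3_cos 0 0 0 (0 : R) (del := 0).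
rewrite lexx ler01 => /(_ isT); rewrite mul0r addr0 => <-.
rewrite -[LHS]mul1e -integral_cst; last exact: measurable_OmegaH3.
by apply: eq_integral => x _; rewrite mul0r addr0.
Qed.

Lemma integrable_OmegaH3_bounded (f : R3 -> R) :
  measurable_fun setT f -> (forall x, `|f x| <= 1) ->
  mu.-integrable OmegaH3 (EFin \o f).
Proof.
move=> mf f1; apply: measurable_bounded_integrable.
- exact: measurable_OmegaH3.
- by rewrite [ltLHS]leb3_OmegaH3 ltry.
- exact: measurable_funTS.
- exists 1; split => // M M1 x _; apply: le_trans (f1 x) _; exact: ltW.
Qed.

Lemma measurable_cos_phase m1 m2 m3 (c : R) :
  measurable_fun setT ((fun x => cos (phase m1 m2 m3 c x)) : R3 -> R).
Proof.
apply: measurableT_comp (measurable_phase m1 m2 m3 c).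
by apply: continuous_measurable_fun; exact: continuous_cos.
Qed.

Lemma integrable_cos_phase m1 m2 m3 (c : R) :
  mu.-integrable OmegaH3 (EFin \o (fun x => cos (phase m1 m2 m3 c x))).
Proof.
by apply: integrable_OmegaH3_bounded => [|x]; [exact: measurable_cos_phase|exact: cos_max].
Qed.

(** Take [del = 1] and cancel the constant 1, whose integral is the measure 1 of the domain. *)
Lemma Rintegral_cos_phase m1 m2 m3 (c : R) :
  Rintegral mu OmegaH3 (fun x => cos (phase m1 m2 m3 c x)) =
  ((m1 == 0) && (m2 == 0) && (m3 == 0))%:R * cos c.
Proof.
have i1 : mu.-integrable OmegaH3 (EFin \o (fun=> 1)).
  apply: (integrable_OmegaH3_bounded (f := cst 1)) => [|x]; first exact: measurable_cst.
  by rewrite normr1.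
have := integral_OmegaH3_cos m1 m2 m3 c (del := 1).
rewrite ler01 lexx => /(_ isT) h.
have : Rintegral mu OmegaH3 (fun x => 1 + cos (phase m1 m2 m3 c x)) =
  1 + ((m1 == 0) && (m2 == 0) && (m3 == 0))%:R * cos c.
  transitivity (fine (\int[mu]_(x in OmegaH3) (1 + 1 * cos (phase m1 m2 m3 c x))%:E)%E).
    by congr fine; apply: eq_integral => x _; rewrite mul1r.
  by rewrite h /= mul1r.
rewrite RintegralD//; last 2 first.
- exact: measurable_OmegaH3.
- exact: integrable_cos_phase.
rewrite Rintegral_cst; last exact: measurable_OmegaH3.
by rewrite [X in fine X]leb3_OmegaH3 mul1r => /addrI.
Qed.

Lemma integrable_OmegaH3D (f g : R3 -> R) :
  mu.-integrable OmegaH3 (EFin \o f) -> mu.-integrable OmegaH3 (EFin \o g) ->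
  mu.-integrable OmegaH3 (EFin \o (fun x => f x + g x)).
Proof.
move=> fi gi; rewrite (_ : EFin \o _ = ((EFin \o f) \+ (EFin \o g))%E)//.
by apply: integrableD => //; exact: measurable_OmegaH3.
Qed.

Lemma integrable_OmegaH3Z (k : R) (f : R3 -> R) :
  mu.-integrable OmegaH3 (EFin \o f) ->
  mu.-integrable OmegaH3 (EFin \o (fun x => k * f x)).
Proof.
move=> fi; rewrite (_ : EFin \o _ = (fun x => k%:E * (EFin \o f) x)%E)//.
by apply: integrableZl => //; exact: measurable_OmegaH3.
Qed.

(** Integrability is bundled with the value so that the predicate passes to finite sums. *)
Definition has_cint (f : R * R * R -> R[i]) (I : R[i]) :=
  [/\ mu.-integrable OmegaH3 (EFin \o (fun x => complex.Re (f x))),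
      mu.-integrable OmegaH3 (EFin \o (fun x => complex.Im (f x))),
      Rintegral mu OmegaH3 (fun x => complex.Re (f x)) = complex.Re I
    & Rintegral mu OmegaH3 (fun x => complex.Im (f x)) = complex.Im I].

Lemma has_cint0 : has_cint (fun=> 0) 0.
Proof.
have i0 : mu.-integrable OmegaH3 (EFin \o (fun=> 0)).
  apply: (integrable_OmegaH3_bounded (f := cst 0)) => [|x]; first exact: measurable_cst.
  by rewrite normr0 ler01.
by split=> //=; rewrite Rintegral_cst ?mul0r//; exact: measurable_OmegaH3.
Qed.

Lemma has_cintD f g I J : has_cint f I -> has_cint g J ->
  has_cint (fun x => f x + g x) (I + J).
Proof.
move=> [f1 f2 f3 f4] [g1 g2 g3 g4].
have mO := @measurable_OmegaH3 R.
have ReD x : complex.Re (f x + g x) = complex.Re (f x) + complex.Re (g x).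
  by case: (f x); case: (g x).
have ImD x : complex.Im (f x + g x) = complex.Im (f x) + complex.Im (g x).
  by case: (f x); case: (g x).
split.
- by under [fun x => complex.Re _]eq_fun do rewrite ReD; exact: integrable_OmegaH3D.
- by under [fun x => complex.Im _]eq_fun do rewrite ImD; exact: integrable_OmegaH3D.
- under [fun x => complex.Re _]eq_fun do rewrite ReD.
  by rewrite RintegralD// f3 g3; case: (I) => ? ?; case: (J).
- under [fun x => complex.Im _]eq_fun do rewrite ImD.
  by rewrite RintegralD// f4 g4; case: (I) => ? ?; case: (J).
Qed.

Lemma has_cint_sum (T : Type) (s : seq T) (P : pred T) (f : T -> R * R * R -> R[i])
    (I : T -> R[i]) : (forall i, P i -> has_cint (f i) (I i)) ->
  has_cint (fun x => \sum_(i <- s | P i) f i x) (\sum_(i <- s | P i) I i).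
Proof.
move=> h; elim: s => [|i s IH].
  by rewrite big_nil; under eq_fun do rewrite big_nil; exact: has_cint0.
rewrite big_cons; under eq_fun do rewrite big_cons.
by case: ifP => // Pi; apply: has_cintD => //; exact: h.
Qed.

Lemma has_cint_phase m1 m2 m3 (a : R[i]) :
  has_cint (fun x => a * (cos (phase m1 m2 m3 0 x) +i* sin (phase m1 m2 m3 0 x))%C)
    (a * ((m1 == 0) && (m2 == 0) && (m3 == 0))%:R).
Proof.
have mO := @measurable_OmegaH3 R.
have ic := integrable_cos_phase m1 m2 m3 0.
have isn := integrable_cos_phase m1 m2 m3 (- (pi / 2)).
have Rc := Rintegral_cos_phase m1 m2 m3 0.
have Rs := Rintegral_cos_phase m1 m2 m3 (- (pi / 2)).
(* Since cos(-pi/2) = 0, the sine parts integrate to 0 for all frequencies. *)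
rewrite cos0 mulr1 in Rc; rewrite cosN cos_pihalf mulr0 in Rs.
have Z := integrable_OmegaH3Z.
have natC (b : bool) : b%:R = ((b%:R : R) +i* 0)%C by case: b.
rewrite natC; case: a => a b; split => /=.
- under [fun x => _ - _]eq_fun do rewrite sin_phase.
  by under eq_fun do rewrite -mulNr; apply: integrable_OmegaH3D; exact: Z.
- under [fun x => _ + _]eq_fun do rewrite sin_phase.
  by apply: integrable_OmegaH3D; exact: Z.
- under [fun x => _ - _]eq_fun do rewrite sin_phase.
  by rewrite RintegralB ?RintegralZl ?Rc ?Rs ?mulr0//; exact: Z.
- under [fun x => _ + _]eq_fun do rewrite sin_phase.
  by rewrite RintegralD ?RintegralZl ?Rc ?Rs ?mulr0 ?add0r//; exact: Z.
Qed.

End ComplexIntegral.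

(** * Sums over the nodes *)

Section Discrete.
Variable R : realType.

Definition expi (t : R) : R[i] := (cos t +i* sin t)%C.

Lemma expiD s t : expi (s + t) = expi s * expi t.
Proof. by rewrite /expi cosD sinD [X in (_ +i* X)%C]addrC. Qed.

Lemma expi0 : expi 0 = 1.
Proof. by rewrite /expi cos0 sin0. Qed.

Lemma expiMn t n : expi (t * n%:R) = expi t ^+ n.
Proof.
elim: n => [|n IH]; first by rewrite mulr0 expi0.
by rewrite exprS -IH -expiD -nat1r mulrDr mulr1.
Qed.

Lemma expiD_int t m : expi (t + 2 * pi * m%:~R) = expi t.
Proof. by rewrite /expi cosD_int sinD_int. Qed.

Lemma expi_int m : expi (2 * pi * m%:~R) = 1.
Proof. by rewrite -[_ * _]add0r expiD_int expi0. Qed.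

(** Here cos t = 1 - 2 sin(t/2)^2, and sin(t/2) > 0 because t/2 lies strictly between 0 and pi. *)
Lemma expi_neq1 t : 0 < t < 2 * pi -> expi t != 1.
Proof.
move=> /andP[t0 t2]; apply/eqP => -[ct _].
have : 0 < sin (t / 2) by apply: sin_gt0_pi; apply/andP; split; lra.
have := cos_mulr2n (t / 2).
rewrite (_ : t / 2 *+ 2 = t) ?ct; last by rewrite -mulr_natr divfK.
have := cos2Dsin2 (t / 2); rewrite -mulr_natr.
set c := cos _; set s := sin _; nra.
Qed.

(** A geometric sum with ratio w satisfying w^N = 1: multiplied by w - 1 it vanishes, and w = 1 when
    N divides m. *)
Lemma sum_expi (N : nat) (m : int) : (0 < N)%N ->
  \sum_(b < N) expi (2 * pi * m%:~R / N%:R * b%:R) = N%:R * (N %| m)%Z%:R.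
Proof.
move=> N0.
have NR0 : N%:R != 0 :> R by rewrite pnatr_eq0 -lt0n.
under eq_bigr do rewrite expiMn.
set w := expi _.
(* Reducing m modulo N brings the angle into [0, 2 pi), where [expi_neq1] applies unless it is 0. *)
have wE : w = expi (2 * pi * (m %% N)%Z%:~R / N%:R).
  rewrite /w {1}(divz_eq m N) rmorphD rmorphM /= mulrDr mulrDl addrC.
  rewrite -[RHS](expiD_int _ (m %/ N)%Z); congr expi; congr (_ + _).
  by rewrite -pmulrn mulrA mulfK.
have wN : w ^+ N = 1 by rewrite -expiMn divfK// expi_int.
case: (boolP (N %| m)%Z) => [/dvdz_mod0P mN|Nm].
  have -> : w = 1 by rewrite wE mN mulr0 mul0r expi0.
  under eq_bigr do rewrite expr1n.
  by rewrite sumr_const card_ord mulr1.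
rewrite mulr0; apply: (mulfI (x := w - 1)).
  rewrite subr_eq0 wE; apply: expi_neq1.
  have mN0 : (m %% N)%Z != 0 by apply: contraNneq Nm => mN; apply/dvdz_mod0P.
  have N0' : N%:Z != 0 by rewrite eqz_nat -lt0n.
  have mge0 : 0 < (m %% N)%Z by rewrite lt_neqAle eq_sym mN0 modz_ge0.
  have mlt : (m %% N)%Z < N%:Z by rewrite ltz_pmod// ltz_nat.
  have pi2 : 0 < 2 * pi :> R by rewrite mulr_gt0// pi_gt0.
  rewrite -mulrA pmulr_rgt0// gtr_pMr// divr_gt0 ?ltr0n ?ltr0z//=.
  by rewrite ltr_pdivrMr ?ltr0n// mul1r -(ltr_int R) in mlt *.
by rewrite mulr0 -subrX1 wN subrr.
Qed.

Lemma sum_nat_mod4 (n : nat) (g : nat -> R[i]) :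
  \sum_(0 <= i < 4 * n) g i = \sum_(s < 4) \sum_(0 <= b < n) g (4 * b + s)%N.
Proof.
rewrite exchange_big /=; elim: n => [|n IH]; first by rewrite muln0 !big_geq.
rewrite mulnS [RHS]big_nat_recr//= -IH !big_ord_recl big_ord0 addr0 /=.
by rewrite addnC !addnS addn0 !big_nat_recr//= !addrA.
Qed.

(** The numbers i - 4n v run once through [-4n, 4n), which contains the box [-3n, 3n]; outside the
    box h vanishes. *)
Lemma sum_zbox (n : nat) (h : int -> R[i]) : (0 < n)%N ->
  (forall a, ~~ (- (3 * n)%:Z <= a <= (3 * n)%:Z) -> h a = 0) ->
  \sum_(a <- zbox n) h a =
  \sum_(0 <= i < 4 * n) \sum_(v <- [:: false; true]) h (i%:Z - (4 * n)%:Z * v%:Z).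
Proof.
move=> n0 h0; rewrite /zbox big_map.
rewrite (_ : iota 0 (6 * n).+1 = index_iota 0 (6 * n).+1)%N; last by rewrite /index_iota subn0.
transitivity (\sum_(0 <= j < 8 * n) h (j%:Z - (4 * n)%:Z)).
  rewrite [RHS](big_cat_nat _ (n := n)) ?leq_pmull//=.
  rewrite [X in _ = X + _]big_nat_cond [X in _ = X + _]big1 ?add0r; last first.
    by move=> i /andP[/andP[_ i1] _]; apply: h0; lia.
  (* With j standing for a + 4n, the box is n <= j < 7n + 1. *)
  rewrite (big_cat_nat _ (n := (7 * n).+1) (m := n)) /=; [|lia|lia].
  rewrite [X in _ = _ + X]big_nat_cond [X in _ = _ + X]big1 ?addr0; last first.
    by move=> i /andP[/andP[i1 i2] _]; apply: h0; lia.
  rewrite -[X in \sum_(X <= _ < (7 * n).+1) _]add0n big_addn.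
  rewrite (_ : ((7 * n).+1 - n = (6 * n).+1)%N); last by lia.
  by apply: eq_bigr => i _; congr h; lia.
rewrite (big_cat_nat _ (n := (4 * n)%N)) //=; last by rewrite leq_mul2r orbT.
rewrite -[X in \sum_(X <= _ < 8 * n) _]add0n big_addn -mulnBl /=.
under [RHS]eq_bigr do rewrite !big_cons big_nil addr0 mulr0 subr0 mulr1.
rewrite [RHS]big_split /= addrC; congr (_ + _).
by apply: eq_bigr => i _; congr h; lia.
Qed.

End Discrete.

(** * The cubature sum of a character *)

Section Cubature.
Variable R : realType.

Lemma sum_bool3 (g : bool * bool * bool -> R[i]) :
  \sum_(v <- bool3) g v = \sum_(v1 <- [:: false; true]) \sum_(v2 <- [:: false; true])
    \sum_(v3 <- [:: false; true]) g (v1, v2, v3).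
Proof. by rewrite /bool3 !big_allpairs_dep. Qed.

Lemma sum_box3 (n : nat) (W : int * int * int -> R[i]) : (0 < n)%N ->
  (forall x, ~~ [&& - (3 * n)%:Z <= x.1.1 <= (3 * n)%:Z, - (3 * n)%:Z <= x.1.2 <= (3 * n)%:Z
    & - (3 * n)%:Z <= x.2 <= (3 * n)%:Z] -> W x = 0) ->
  \sum_(x <- box3 n) W x = \sum_(0 <= i < 4 * n) \sum_(0 <= j < 4 * n)
    \sum_(0 <= k < 4 * n) \sum_(v <- bool3) W (cshift (4 * n) (i%:Z, j%:Z, k%:Z) v).
Proof.
move=> n0 W0; rewrite /box3 !big_allpairs_dep.
rewrite sum_zbox//; last first.
  move=> a ha; apply: big1 => b _; apply: big1 => c _; apply: W0.
  by rewrite (negbTE ha).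
apply: eq_bigr => i _.
under [RHS]eq_bigr => j _ do under eq_bigr => k _ do rewrite sum_bool3.
under [RHS]eq_bigr => j _ do rewrite exchange_big.
rewrite [RHS]exchange_big; apply: eq_bigr => v1 _.
rewrite sum_zbox//; last first.
  move=> b hb; apply: big1 => c _; apply: W0.
  by rewrite (negbTE hb) andbF.
apply: eq_bigr => j _; rewrite [RHS]exchange_big; apply: eq_bigr => v2 _.
rewrite sum_zbox//; last first.
  by move=> c hc; apply: W0; rewrite (negbTE hc) !andbF.
Qed.

(** Four times a coordinate is the sum of its three differences with the others, each at most 4n in
    absolute value. *)
Lemma inHstar_bounded (n : nat) (x : int * int * int) : inHstar n (vec_of3 x) ->
  [&& - (3 * n)%:Z <= x.1.1 <= (3 * n)%:Z, - (3 * n)%:Z <= x.1.2 <= (3 * n)%:Z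
    & - (3 * n)%:Z <= x.2 <= (3 * n)%:Z].
Proof.
rewrite inHstar_vec_of3 => /andP[_ /allI4_pairP h].
move: (h 0%N 1%N isT isT) (h 0%N 2%N isT isT) (h 0%N 3%N isT isT)
      (h 1%N 2%N isT isT) (h 1%N 3%N isT isT) (h 2%N 3%N isT isT).
by rewrite /vec4 /=; lia.
Qed.

Definition node3 (n : nat) (x : int * int * int) : R * R * R :=
  (x.1.1%:~R / (4 * n)%:R, x.1.2%:~R / (4 * n)%:R, x.2%:~R / (4 * n)%:R).

Lemma node3_cshift n x v : (0 < n)%N ->
  node3 n (cshift (4 * n) x v) = tshift (node3 n x) v.
Proof.
move=> n0; rewrite /node3 /cshift /tshift /=.
have E (a : int) (b : bool) : (a - (4 * n)%:Z * b%:Z)%:~R / (4 * n)%:R =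
    a%:~R / (4 * n)%:R - (b : nat)%:R :> R.
  rewrite rmorphB rmorphM /= -!pmulrn mulrBl mulrAC divff ?mul1r//.
  by rewrite pnatr_eq0 muln_eq0 /= -lt0n.
by rewrite !E.
Qed.

Lemma expi_phase_tshift m1 m2 m3 (x : R * R * R) v :
  expi (phase m1 m2 m3 0 (tshift x v)) = expi (phase m1 m2 m3 0 x).
Proof.
by rewrite /expi !sin_phase !cos_phase_tshift.
Qed.

(** Nodes are grouped by their first three coordinates modulo 4n. F is constant on each group, and
    by [cweight_tiling] the weights of a group add up to 1; groups with residues not congruent
    modulo 4 contain no node. *)
Lemma cubature_fold (n : nat) (F : R * R * R -> R[i]) : (0 < n)%N ->
  (forall x v, F (tshift x v) = F x) ->
  \sum_(x <- box3 n | inHstar n (vec_of3 x))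
     ((cweight R n (vec_of3 x))%:C)%C * F (node3 n x) =
  \sum_(0 <= i < 4 * n) \sum_(0 <= j < 4 * n) \sum_(0 <= k < 4 * n)
     (if (4 %| i%:Z - j%:Z)%Z && (4 %| i%:Z - k%:Z)%Z then F (node3 n (i%:Z, j%:Z, k%:Z)) else 0).
Proof.
move=> n0 FT; rewrite big_mkcond /= sum_box3//; last first.
  by move=> x; case: ifP => // /inHstar_bounded ->.
apply: eq_big_nat => i /andP[_ i4]; apply: eq_big_nat => j /andP[_ j4].
apply: eq_big_nat => k /andP[_ k4].
set x := (i%:Z, j%:Z, k%:Z).
transitivity ((\sum_(v <- bool3) (if inHstar n (vec_of3 (cshift (4 * n) x v)) then
    cweight R n (vec_of3 (cshift (4 * n) x v)) else 0))%:C%C * F (node3 n x)).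
  rewrite rmorph_sum /= mulr_suml; apply: eq_bigr => v _.
  by case: ifP => _; rewrite ?mul0r// node3_cshift// FT.
case: ifPn => [xd|xnd].
  rewrite cweight_tiling ?mul1r//=; lia.
rewrite big1 ?mul0r// => v _; rewrite ifF//; apply: contraNF xnd.
rewrite inHstar_vec_of3 => /andP[+ _]; rewrite /cshift /=.
by case: v => [[[] []] []] /=; lia.
Qed.

(** Congruent indices share one residue s modulo 4, each keeping a free quotient below n. *)
Lemma sum_congruent (n : nat) (G : nat -> nat -> nat -> R[i]) :
  \sum_(0 <= i < 4 * n) \sum_(0 <= j < 4 * n) \sum_(0 <= k < 4 * n)
     (if (4 %| i%:Z - j%:Z)%Z && (4 %| i%:Z - k%:Z)%Z then G i j k else 0) =
  \sum_(s < 4) \sum_(0 <= i < n) \sum_(0 <= j < n) \sum_(0 <= k < n)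
     G (4 * i + s)%N (4 * j + s)%N (4 * k + s)%N.
Proof.
have E (h : nat -> R[i]) (a : nat) (s : 'I_4) :
    \sum_(0 <= j < 4 * n) (if (4 %| (4 * a + s)%N%:Z - j%:Z)%Z then h j else 0) =
    \sum_(0 <= j < n) h (4 * j + s)%N.
  rewrite sum_nat_mod4 (bigD1 s) //= [X in _ + X]big1 ?addr0 => [|t ts].
    by apply: eq_bigr => j _; rewrite ifT//; lia.
  apply: big1 => j _; rewrite ifF//; apply: contraNF ts => h'.
  by apply/eqP/val_inj; move: (ltn_ord s) (ltn_ord t) h' => /=; lia.
rewrite sum_nat_mod4; apply: eq_bigr => s _; apply: eq_bigr => i _.
rewrite -(E (fun j => \sum_(0 <= k < n) G (4 * i + s)%N j (4 * k + s)%N) i).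
apply: eq_bigr => j _; case: ifP => _ /=; first exact: E.
by rewrite big1.
Qed.

(** At indices 4i+s, 4j+s, 4k+s the character splits into factors in s, i, j and k separately, so
    the sum is a product of four geometric sums. *)
Lemma cubature_expi (n : nat) (m1 m2 m3 : int) : (0 < n)%N ->
  \sum_(x <- box3 n | inHstar n (vec_of3 x))
     ((cweight R n (vec_of3 x))%:C)%C * expi (phase m1 m2 m3 0 (node3 n x)) =
  (4 * n ^ 3)%:R * [&& (n %| m1)%Z, (n %| m2)%Z, (n %| m3)%Z
                     & ((4 * n)%:Z %| m1 + m2 + m3)%Z]%:R.
Proof.
move=> n0; rewrite (cubature_fold (F := fun x => expi (phase m1 m2 m3 0 x))) //; last first.
  by move=> x v; exact: expi_phase_tshift.
rewrite (sum_congruent n (fun i j k => expi (phase m1 m2 m3 0 (node3 n (i%:Z, j%:Z, k%:Z))))).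
pose e (m : int) (N b : nat) : R[i] := expi (2 * pi * m%:~R / N%:R * b%:R).
transitivity (\sum_(s < 4) \sum_(0 <= i < n) \sum_(0 <= j < n) \sum_(0 <= k < n)
    (e (m1 + m2 + m3) (4 * n)%N s * (e m1 n i * (e m2 n j * e m3 n k)))).
  apply: eq_bigr => s _; do 3![apply: eq_bigr => ? _].
  rewrite /e -!expiD; congr expi; rewrite /phase /node3 /= !rmorphD /= -!pmulrn.
  have : n%:R != 0 :> R by rewrite pnatr_eq0 -lt0n.
  by move=> nR; field; rewrite nR -!natrD pnatr_eq0; lia.
have eS m : \sum_(0 <= b < n) e m n b = n%:R * (n %| m)%Z%:R.
  by rewrite big_mkord sum_expi.
transitivity ((\sum_(s < 4) e (m1 + m2 + m3) (4 * n)%N s) *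
    ((\sum_(0 <= b < n) e m1 n b) * ((\sum_(0 <= b < n) e m2 n b) *
      (\sum_(0 <= b < n) e m3 n b)))).
  rewrite mulr_suml; apply: eq_bigr => s _.
  rewrite mulr_suml mulr_sumr; apply: eq_bigr => i _.
  rewrite [_ * (_ * _)]mulrCA mulr_suml mulr_sumr mulr_sumr; apply: eq_bigr => j _.
  by rewrite !mulr_sumr; apply: eq_bigr => k _; rewrite mulrCA.
rewrite !eS.
have [/= d1|] := boolP (n %| m1)%Z; last by rewrite !(mulr0, mul0r).
have [/= d2|] := boolP (n %| m2)%Z; last by rewrite !(mulr0, mul0r).
have [/= d3|] := boolP (n %| m3)%Z; last by rewrite !(mulr0, mul0r).
(* The sum over s has 4 terms but denominator 4n; as n now divides m1 + m2 + m3, it becomes a full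
   geometric sum of length 4. *)
have [M ME] : exists M, m1 + m2 + m3 = M * n%:Z.
  by apply/dvdzP; rewrite !rpredD.
have nZ : n%:Z != 0 by rewrite eqz_nat -lt0n.
rewrite ME PoszM dvdz_mul2r//.
rewrite (eq_bigr (fun s : 'I_4 => expi (2 * pi * M%:~R / 4%:R * s%:R))); last first.
  move=> s _; rewrite /e; congr expi; rewrite rmorphM /= -pmulrn natrM.
  have : n%:R != 0 :> R by rewrite pnatr_eq0 -lt0n.
  by move=> ?; field.
rewrite sum_expi// natrM natrX; ring.
Qed.

End Cubature.

(** * Frequencies of T_(2n-1) and comparison of both sides *)

Section Final.
Variable R : realType.

Definition freq (y : int * int * int) (i : nat) : int := ((vec4 y i - vec4 y 3) %/ 4)%Z.

Lemma freqE y i : inHlat (vec_of3 y) -> (i < 4)%N -> vec4 y i - vec4 y 3 = freq y i * 4.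
Proof.
rewrite inHlat_vec_of3 => /andP[d1 d2] i4; rewrite /freq divzK//.
by move: i4; do 4?[case: i => [|i]]; rewrite /vec4 //= => _; lia.
Qed.

(** As the point has coordinate sum 0, subtracting k_4 from every k_i leaves the dot product
    unchanged; the differences are 4 m_i, and pi/2 times 4 is 2 pi. *)
Lemma phi_embH (y : int * int * int) (x : R * R * R) : inHlat (vec_of3 y) ->
  phi (vec_of3 y) (embH x) = expi (phase (freq y 0) (freq y 1) (freq y 2) 0 x).
Proof.
move=> yH; rewrite /phi -/(expi _); congr expi.
have E i : (i < 4)%N -> (freq y i)%:~R = ((vec4 y i)%:~R - (vec4 y 3)%:~R) / 4 :> R.
  by move=> i4; rewrite -rmorphB/= freqE// rmorphM/= mulfK.
rewrite /phase !E// /dotZR !big_ord_recl big_ord0 /vec_of3 /embH /vec4 /=.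
rewrite !(rmorphN, rmorphD) /=.
by field.
Qed.

Lemma scale_pt_vec_of3 (n : nat) (x : int * int * int) :
  scale_pt R n (vec_of3 x) = embH (node3 R n x).
Proof.
apply/funext => -[i i4]; rewrite /scale_pt /vec_of3 /embH /node3 /=.
do 4?[case: i i4 => [|i] i4 //=].
by rewrite !(rmorphN, rmorphD) /= -!mulrDl mulNr.
Qed.

(** Write the frequencies as n times a, b, c. The bounds force a, b, c and their differences into
    {-1, 0, 1}, while 4 divides a + b + c. *)
Lemma freq_exact (n : nat) (y : int * int * int) : (0 < n)%N ->
  inHstar (2 * n - 1) (vec_of3 y) ->
  [&& (n %| freq y 0)%Z, (n %| freq y 1)%Z, (n %| freq y 2)%Z
    & ((4 * n)%:Z %| freq y 0 + freq y 1 + freq y 2)%Z] =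
  (freq y 0 == 0) && (freq y 1 == 0) && (freq y 2 == 0).
Proof.
move=> n0 yH; have yL : inHlat (vec_of3 y) by case/andP: yH.
move: yH; rewrite inHstar_vec_of3 => /andP[_ /allI4_pairP h].
move: (h 0%N 1%N isT isT) (h 0%N 2%N isT isT) (h 0%N 3%N isT isT)
      (h 1%N 2%N isT isT) (h 1%N 3%N isT isT) (h 2%N 3%N isT isT) => {h}.
move: (freqE (i := 0) yL isT) (freqE (i := 1) yL isT) (freqE (i := 2) yL isT).
move: (vec4 y 0) (vec4 y 1) (vec4 y 2) (vec4 y 3) => y0 y1 y2 y3.
move: (freq y 0) (freq y 1) (freq y 2) => m0 m1 m2 /= E0 E1 E2 b01 b02 b03 b12 b13 b23.
apply/idP/idP => [/and4P[/dvdzP[a aE] /dvdzP[b bE] /dvdzP[c cE] /dvdzP[d dE]]|]; last first.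
  by move=> /andP[/andP[/eqP-> /eqP->] /eqP->]; rewrite !addr0 !dvdz0.
have nZ : n%:Z != 0 by rewrite eqz_nat -lt0n.
have {dE} dE : a + b + c = d * 4.
  by apply: (mulIf nZ); rewrite !mulrDl -aE -bE -cE dE PoszM mulrA.
(* From |t| n <= 2n - 1 < 2n follows |t| < 2: this is where the degree 2n - 1 enters. *)
have bnd (t : int) : - (4 * (2 * n - 1))%N%:Z <= t * n%:Z * 4 <= (4 * (2 * n - 1))%N%:Z ->
    -1 <= t <= 1.
  by move=> /andP[? ?]; apply/andP; split; nia.
have a1 : -1 <= a <= 1 by apply: bnd; rewrite -aE; lia.
have b1 : -1 <= b <= 1 by apply: bnd; rewrite -bE; lia.
have c1 : -1 <= c <= 1 by apply: bnd; rewrite -cE; lia.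
have ab1 : -1 <= a - b <= 1 by apply: bnd; rewrite mulrBl -aE -bE; lia.
have ac1 : -1 <= a - c <= 1 by apply: bnd; rewrite mulrBl -aE -cE; lia.
have bc1 : -1 <= b - c <= 1 by apply: bnd; rewrite mulrBl -bE -cE; lia.
(* A multiple of 4 of absolute value at most 3 is 0; were a, b, c not all zero, both 1 and -1 would
   occur, at distance 2. *)
have [a0 b0 c0] : [/\ a = 0, b = 0 & c = 0] by split; lia.
by rewrite aE bE cE a0 b0 c0 !mul0r !eqxx.
Qed.

Lemma int_OmegaH_cint (f : vecR R -> R[i]) (I : R[i]) :
  has_cint (fun x => f (embH x)) I -> int_OmegaH f = 2%:R * I.
Proof.
move=> [_ _ hRe hIm]; rewrite /int_OmegaH -/(@OmegaH3 R) hRe hIm.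
have -> : 2%:R = ((2%:R : R) +i* 0)%C :> R[i] by rewrite -[LHS](rmorph_nat (real_complex R)).
by case: I {hRe hIm} => a b; apply/eqP; rewrite eq_complex /= !mul0r subr0 addr0 !eqxx.
Qed.

End Final.
Unset Implicit Arguments.

Theorem theorem3p16 (R : realType) (n : nat) (hn : (1 <= n)%N)
    (f : vecR R -> R[i]) (hf : inT (2 * n - 1) f) :
  (2%:R)^-1 * int_OmegaH f =
  ((4 * n ^ 3)%:R)^-1 *
    sum_Hstar n (fun j => ((cweight R n j)%:C)%C * f (scale_pt R n j)).
Proof.
have [a fE] := hf.
pose delta y : R[i] := ((freq y 0 == 0) && (freq y 1 == 0) && (freq y 2 == 0))%:R.
have fembE x : f (embH x) = \sum_(y <- box3 (2 * n - 1) | inHstar (2 * n - 1) (vec_of3 y))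
    a (vec_of3 y) * expi (phase (freq y 0) (freq y 1) (freq y 2) 0 x).
  rewrite fE; last exact: embH_sum.
  by apply: eq_bigr => y yH; rewrite phi_embH//; case/andP: yH.
rewrite (@int_OmegaH_cint _ _ (\sum_(y <- box3 (2 * n - 1) | inHstar (2 * n - 1) (vec_of3 y))
    a (vec_of3 y) * delta y)); last first.
  under eq_fun do rewrite fembE.
  by apply: has_cint_sum => y _; exact: has_cint_phase.
rewrite mulKf ?pnatr_eq0//.
have n4 : (4 * n ^ 3)%:R != 0 :> R[i].
  by rewrite pnatr_eq0 muln_eq0 expn_eq0 /= andbT -lt0n.
apply: (mulfI n4); rewrite mulVKf// /sum_Hstar.
under [RHS]eq_bigr => x _ do rewrite scale_pt_vec_of3 fembE mulr_sumr.
(* Both sides are linear in the coefficients [a], so characters are compared one by one: the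
   weighted node sum of each is 4n^3 times its [delta]. *)
rewrite exchange_big mulr_sumr; apply: eq_bigr => y yH.
rewrite mulrCA /delta -(freq_exact hn yH) -cubature_expi// mulr_sumr.
by apply: eq_bigr => x _; rewrite mulrCA.
Qed.
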